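(* Let $t\ge 1$ be an odd integer. Then the graph $B_{2t}$ has a perfect matching of König type.
   Context: For an integer $t\ge 1$, $B_{2t}$ is the simple graph with vertex set $\{v_1,\dots,v_{3t+3}\}$ and edge set $\{\{v_i,v_{i+1}\} : 1\le i\le 3t+2,\ i\ne t+1,\ i\neq 2t+2\}\cup\{\{v_i,v_{i+t+1}\} : 1\le i\le 2t+2\}$ (a grid of unit squares with 2 rows and $t$ columns of squares). The edge ideal $I_G$ of a graph $G$ on $v_1,\dots,v_n$ is the ideal of $K[X_1,\dots,X_n]$ ($K$ a field) generated by all monomials $X_iX_j$ with $\{v_i,v_j\}$ an edge of $G$. A perfect matching of König type of a graph $G$ is a collection $e_1,\dots,e_g$ of pairwise disjoint edges whose union (of endpoints) is the whole vertex set of $G$ and such that $g$ equals the height of $I_G$. *)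

(* Defs.v *)
From HB Require Import structures.
From mathcomp Require Import all_boot all_order all_algebra.
From mathcomp Require Export mpoly.

Set Implicit Arguments.
Unset Strict Implicit.
Unset Printing Implicit Defensive.

Import GRing.Theory.
Local Open Scope ring_scope.

Section Height.
Variable R : comNzRingType.

(* [idealr_closed] already forces 1 \notin P.  Using boolean predicates is no
   restriction on the primes considered: classically every subset of R is one. *)
Definition prime_ideal (P : {pred R}) : Prop :=
  idealr_closed P /\ prime_idealr_closed P.

Definition strict_subset (P Q : {pred R}) : Prop :=
  {subset P <= Q} /\ ~ {subset Q <= P}.

(* A chain of primes c 0 < c 1 < ... < c m = P: m strict inclusions. *)
Definition prime_chain (P : {pred R}) (m : nat) : Prop :=
  exists c : nat -> {pred R},
    [/\ forall i, (i <= m)%N -> prime_ideal (c i),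
        forall i, (i < m)%N -> strict_subset (c i) (c i.+1)
      & c m =i P].

Definition prime_has_height (P : {pred R}) (h : nat) : Prop :=
  prime_chain P h /\ forall m, prime_chain P m -> (m <= h)%N.

Definition prime_over (J : R -> Prop) (P : {pred R}) : Prop :=
  prime_ideal P /\ forall f, J f -> f \in P.

(* The height of J is the minimum of the heights of the primes containing J.
   The second clause says ht P >= h, and so also covers primes of infinite
   height. *)
Definition ideal_has_height (J : R -> Prop) (h : nat) : Prop :=
  (exists P, prime_over J P /\ prime_has_height P h) /\
  (forall P, prime_over J P -> exists2 m, (h <= m)%N & prime_chain P m).

Definition ideal_generated (S : R -> Prop) (f : R) : Prop :=
  exists2 s : seq (R * R),
    (forall p, p \in s -> S p.2) & f = \sum_(p <- s) p.1 * p.2.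

End Height.

(* Simple graphs on v_1, ..., v_n; the vertex v_(i+1) is i : 'I_n. *)
Record simple_graph (n : nat) := SimpleGraph {
  edges : {set {set 'I_n}};
  edges_card2 : forall e, e \in edges -> #|e| = 2%N
}.

Definition edge_monomial (K : fieldType) (n : nat) (G : simple_graph n)
    (f : {mpoly K[n]}) : Prop :=
  exists i j : 'I_n, [set i; j] \in edges G /\ f = 'X_i * 'X_j.

Definition edge_ideal (K : fieldType) (n : nat) (G : simple_graph n) :
    {mpoly K[n]} -> Prop :=
  ideal_generated (@edge_monomial K n G).
Arguments edge_ideal K {n} G f.

Definition perfect_matching_Konig (K : fieldType) (n : nat)
    (G : simple_graph n) (M : {set {set 'I_n}}) : Prop :=
  [/\ M \subset edges G,
      trivIset M,
      cover M = [set: 'I_n]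
    & ideal_has_height (edge_ideal K G) #|M|].

(* [B_arc t a b]: {v_a, v_b} is one of the listed edges, with 1-based labels
   a < b. *)
Definition B_arc (t a b : nat) : bool :=
  [&& (1 <= a <= 3 * t + 2)%N, a != (t + 1)%N, a != (2 * t + 2)%N
    & b == (a + 1)%N]
  || ((1 <= a <= 2 * t + 2)%N && (b == (a + t + 1)%N)).

Definition B_edges (t : nat) : {set {set 'I_(3 * t + 3)}} :=
  [set [set p.1; p.2]
     | p : 'I_(3 * t + 3) * 'I_(3 * t + 3) & B_arc t p.1.+1 p.2.+1].

Lemma B_arc_lt t a b : B_arc t a b -> (a < b)%N.
Proof.
case/orP => [/and4P[_ _ _ /eqP ->]|/andP[_ /eqP ->]]; first by rewrite addn1.
by rewrite addn1 ltnS leq_addr.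
Qed.

Lemma B_edges_card2 t (e : {set 'I_(3 * t + 3)}) :
  e \in B_edges t -> #|e| = 2%N.
Proof.
case/imsetP => p; rewrite inE => /B_arc_lt; rewrite ltnS => lt_p ->.
by rewrite cards2 -val_eqE /= neq_ltn lt_p.
Qed.

(* The graph B_{2t} (2 rows and t columns of unit squares). *)
Definition B_graph (t : nat) : simple_graph (3 * t + 3) :=
  SimpleGraph (@B_edges_card2 t).

(* Main.v *)
(* A prime containing the edge ideal contains a variable from every edge of a
    matching M, hence has height at least #|M|; if C is a vertex cover with
    #|C| = #|M|, the prime generated by the variables in C has height exactly
    #|C|.  The upper bound reduces to dim K[X_1, ..., X_n] <= n: along a chain
    c 0 < ... < c m pick f_i in c (i+1) minus c i; the N^m products of powers
    < N of the f_i are linearly independent modulo c 0, while their degrees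
    are O(N), so that they lie in a space of dimension O(N^n).

    In B_{2t} with t odd, each of the three rows has an even number t + 1 of
    vertices: pair consecutive vertices of each row, and let C be one of the
    two colour classes of the (bipartite) grid. *)

From Stdlib Require Import Classical.
Require Import Defs.
From mathcomp Require Import all_boot all_order all_algebra.
From mathcomp Require Import zify.

Set Implicit Arguments.
Unset Strict Implicit.
Unset Printing Implicit Defensive.

Import GRing.Theory.

(** * Closure properties of prime ideals *)

Section PrimeIdeals.
Local Open Scope ring_scope.
Variables (R : comNzRingType) (P : {pred R}).
Hypothesis prP : prime_ideal P.

Lemma prime_ideal0 : 0 \in P. Proof. by case: prP => -[]. Qed.

Lemma prime_ideal1 : 1 \notin P. Proof. by case: prP => -[]. Qed.

Lemma prime_idealMD a u v : u \in P -> v \in P -> a * u + v \in P.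
Proof. by case: prP => -[_ _ PMD] _; apply: PMD. Qed.

Lemma prime_idealM a u : u \in P -> a * u \in P.
Proof. by move=> Pu; rewrite -[a * u]addr0 prime_idealMD ?prime_ideal0. Qed.

Lemma prime_idealBM a u v : v \in P -> u + a * v \in P -> u \in P.
Proof.
by move=> Pv /(prime_idealMD (- a) Pv); rewrite addrC mulNr addrK.
Qed.

Lemma prime_idealM_or u v : u * v \in P -> u \in P \/ v \in P.
Proof. by case: prP => _ /[apply] /orP. Qed.

Lemma prime_chain0 : prime_chain P 0.
Proof. by exists (fun=> P); split. Qed.

End PrimeIdeals.

(** * Chains of primes *)

Section Chains.
Local Open Scope ring_scope.
Variable R : comNzRingType.
Implicit Types P Q : {pred R}.

Lemma prime_chainS P Q m :
  prime_chain P m -> prime_ideal Q -> strict_subset P Q -> prime_chain Q m.+1.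
Proof.
move=> [c [c_pr c_str cmP]] prQ [PQ nQP].
exists (fun i => if (i <= m)%N then c i else Q); split=> [i _|i|] /=.
- by case: ifP => // /c_pr.
- rewrite ltnS leq_eqVlt => /orP[/eqP->|im].
    rewrite eqxx ltnn; split=> [x|sQ]; first by rewrite cmP; apply: PQ.
    by apply: nQP => x /sQ; rewrite cmP.
  by rewrite im orbT; apply: c_str.
- by rewrite ltnn.
Qed.

(** Modulo [Q] only the term [h 0] survives, so it vanishes; the rest is [f] times a shorter sum of
    the same shape, and [f] cancels modulo the prime [P]. *)
Lemma sum_expM_prime_eq0 (P Q : {pred R}) (f : R) N (h : nat -> R) :
    prime_ideal P -> prime_ideal Q -> {subset P <= Q} -> f \in Q -> f \notin P ->
    (forall j, h j \in Q -> h j = 0) -> \sum_(j < N) f ^+ j * h j \in P ->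
  forall j, (j < N)%N -> h j = 0.
Proof.
move=> prP prQ PQ Qf nPf; elim: N h => // N IHN h hQ.
rewrite big_ord_recl expr0 mul1r.
under eq_bigr do rewrite lift0 exprS -mulrA.
rewrite -mulr_sumr => Psum.
have h0 : h 0 = 0.
  by apply/hQ/(prime_idealBM prQ Qf); rewrite mulrC; apply: PQ Psum.
move: Psum; rewrite h0 add0r => /(prime_idealM_or prP)[Pf|Psum].
  by rewrite Pf in nPf.
by case=> // j; apply: (IHN (fun j => h j.+1)) => // i; apply: hQ.
Qed.

End Chains.

(** * The dimension of a polynomial ring in n variables is at most n *)

Section Dimension.
Local Open Scope ring_scope.
Variables (K : fieldType) (n : nat).
Local Notation R := {mpoly K[n]}.

Lemma msize_expM_le (f g : R) j k :
  (msize g <= k.+1)%N -> (msize (f ^+ j * g) <= (msize f * j + k).+1)%N.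
Proof.
move=> gk; elim: j => [|j IHj]; first by rewrite mul1r muln0.
rewrite exprS -mulrA mulnS.
have [->|nz_f] := eqVneq f 0; first by rewrite mul0r msize0.
have [->|nz_h] := eqVneq (f ^+ j * g) 0; first by rewrite mulr0 msize0.
by rewrite msizeM // (leq_trans (leq_pred _)) // -addnA -addnS leq_add2l.
Qed.

(** Induction on the chain above [c 0]: a family free modulo [c 1] is multiplied by the powers below
    [N] of some [f] in [c 1] but not in [c 0]. The slope [d] depends on the chain but not on [N],
    which makes a comparison of growth rates possible. *)
Lemma prime_chain_free m (c : nat -> {pred R}) :
    (forall i, (i <= m)%N -> prime_ideal (c i)) ->
    (forall i, (i < m)%N -> strict_subset (c i) (c i.+1)) ->
  exists d, forall N, exists (I : finType) (g : I -> R),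
    [/\ #|I| = (N ^ m)%N, forall i, (msize (g i) <= (d * N).+1)%N
      & forall a : I -> K, \sum_i a i *: g i \in c 0 -> forall i, a i = 0].
Proof.
elim: m c => [|m IHm] c c_pr c_str.
  exists 0 => N; exists unit, (fun=> 1); split=> [||a]; rewrite ?card_unit //.
    by move=> _; rewrite msize1.
  rewrite (big_pred1 tt) => [|[]//] ca []; apply/eqP/negPn/negP => a_nz.
  have/negP := prime_ideal1 (c_pr 0 isT); apply.
  have := prime_idealM (c_pr 0 isT) ((a tt)^-1)%:MP ca.
  by rewrite mul_mpolyC scalerA mulVf // scale1r.
have [||d Hd] := IHm (c \o succn); [by move=> i im; apply: c_pr| |].
  by move=> i im; apply: c_str.
have [c01 nc10] := c_str 0 isT.
have [f cf] : exists f, ~ (f \in c 1 -> f \in c 0) by apply: not_all_ex_not.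
have [c1f /negP nc0f] := imply_to_and _ _ cf.
exists (msize f + d)%N => N; have [I [g [cardI sz_g g_free]]] := Hd N.
exists ('I_N * I)%type, (fun p : 'I_N * I => f ^+ p.1 * g p.2); split.
- by rewrite card_prod card_ord cardI expnS.
- move=> [j i] /=; apply: leq_trans (msize_expM_le _ _ (sz_g i)) _.
  by rewrite ltnS mulnDl leq_add2r leq_mul2l (ltnW (ltn_ord j)) orbT.
move=> a.
(* The value 0 beyond [N] keeps the condition that [h j] in [c 1] forces [h j = 0] true for every
   natural number [j]. *)
pose h (j : nat) := if insub j is Some j' then \sum_i a (j', i) *: g i else 0.
have hE (j : 'I_N) : h j = \sum_i a (j, i) *: g i by rewrite /h valK.
have -> : \sum_p a p *: (f ^+ p.1 * g p.2) = \sum_(j < N) f ^+ j * h j.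
  under [RHS]eq_bigr do rewrite hE mulr_sumr.
  rewrite pair_big /=; apply: eq_bigr => -[j i] _ /=.
  by rewrite scalerAr.
move=> csum [j i]; apply: (g_free (fun i => a (j, i))); rewrite -hE.
rewrite (sum_expM_prime_eq0 _ _ c01 c1f nc0f _ csum) //.
- exact: prime_ideal0 (c_pr 1 isT).
- exact: c_pr.
- exact: c_pr.
- rewrite /h => j'; case: insubP => //= j'' _ _ /(g_free (fun i => a (j'', i))) a0.
  by rewrite big1 // => i' _; rewrite a0 scale0r.
Qed.

(** All exponents in the [g i] are below [D], so at most [D ^ n] coefficients matter; the
    coefficient matrix has more rows than columns, hence a nonzero left kernel. *)
Lemma mpoly_lin_dep D (I : finType) (g : I -> R) :
    (D ^ n < #|I|)%N -> (forall i, (msize (g i) <= D)%N) ->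
  exists a : I -> K, \sum_i a i *: g i = 0 /\ exists i, a i != 0.
Proof.
move=> ltI sz_g.
pose mon (e : {ffun 'I_n -> 'I_D}) := [multinom (e i : nat) | i < n].
pose A := \matrix_(i < #|I|, j < #|{ffun 'I_n -> 'I_D}|)
            (g (enum_val i))@_(mon (enum_val j)).
have : kermx A != 0.
  rewrite -mxrank_eq0 mxrank_ker subn_eq0 -ltnNge.
  by apply: leq_ltn_trans (rank_leq_col A) _; rewrite card_ffun !card_ord.
case/rowV0Pn => v /sub_kermxP vA v_nz.
exists (fun i => v 0 (enum_rank i)); split; last first.
  by have /rV0Pn[i vi] := v_nz; exists (enum_val i); rewrite enum_valK.
apply/mpolyP => m; rewrite raddf_sum mcoeff0 /=.
have [lt_mD|/forallPn/=[k]] := boolP [forall k, m k < D]%N; last first.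
  rewrite -leqNgt => leDm; apply: big1 => i _; rewrite mcoeffZ memN_msupp_eq0 ?mulr0 //.
  apply: msize_mdeg_ge; apply: leq_trans (sz_g i) (leq_trans leDm _).
  by rewrite mdegE (bigD1 k) //= leq_addr.
pose e := [ffun k => Ordinal (forallP lt_mD k)].
have def_m : mon e = m by apply/mnmP => k; rewrite mnmE ffunE.
have /matrixP/(_ 0 (enum_rank e)) := vA; rewrite !mxE; apply: etrans.
rewrite (reindex_onto enum_val enum_rank) /=; last by move=> i _; apply: enum_rankK.
apply: eq_big => [i|i _]; first by rewrite enum_valK eqxx.
by rewrite mcoeffZ enum_valK mxE enum_rankK def_m.
Qed.

Lemma prime_chain_mpoly_le (P : {pred R}) m : prime_chain P m -> (m <= n)%N.
Proof.
move=> [c [c_pr c_str _]]; rewrite leqNgt; apply/negP => lt_nm.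
have [d Hd] := prime_chain_free c_pr c_str.
(* With [N] larger than [d.+1 ^ n], one gets [(d.+1 * N) ^ n < N ^ n.+1 <= N ^ m]: more free
   polynomials than their degrees allow. *)
have [I [g [cardI sz_g g_free]]] := Hd (d.+1 ^ n).+1.
set N := (d.+1 ^ n).+1 in cardI sz_g.
have [||a [sum0 [i ai]]] := @mpoly_lin_dep (d.+1 * N) I g.
- rewrite cardI expnMn; apply: leq_trans (leq_pexp2l _ lt_nm) => //.
  by rewrite expnS ltn_pmul2r ?expn_gt0.
- by move=> i; apply: leq_trans (sz_g i) _; rewrite mulSn -add1n leq_add2r.
case/eqP: ai; apply: g_free; rewrite sum0.
exact: prime_ideal0 (c_pr 0 isT).
Qed.

End Dimension.

(** * Primes generated by variables, and their heights *)

Section VariableIdeals.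
Local Open Scope ring_scope.
Variables (K : fieldType) (n : nat).
Local Notation R := {mpoly K[n]}.
Implicit Types (A C : {set 'I_n}) (P : {pred R}).

Definition kill_vars A : n.-tuple R :=
  [tuple if i \in A then 0 else 'X_i | i < n].

(** The ideal generated by the variables in [A], encoded as the kernel of a substitution, so that
    primality comes from the target being a domain. *)
Definition var_ideal A : {pred R} := [pred f : R | f \mPo kill_vars A == 0].

Lemma var_idealX A i : ('X_i \in var_ideal A) = (i \in A).
Proof.
rewrite inE comp_mpolyXU -tnth_nth tnth_mktuple.
by case: ifP; rewrite ?eqxx // -msize_poly_eq0 msizeX.
Qed.

Lemma var_ideal_prime A : prime_ideal (var_ideal A).
Proof.
split; first split.
- by rewrite inE comp_mpoly0.
- by rewrite inE comp_mpoly1 oner_eq0.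
- move=> a u v; rewrite !inE => /eqP u0 /eqP v0.
  by rewrite comp_mpolyD rmorphM /= u0 v0 mulr0 addr0.
- by move=> u v; rewrite !inE rmorphM /= mulf_eq0.
Qed.

Lemma var_ideal_sub A P :
  prime_ideal P -> (forall i, i \in A -> 'X_i \in P) -> {subset var_ideal A <= P}.
Proof.
move=> prP PA f; rewrite inE => /eqP f0.
(* Setting the variables in [A] to 0 does not change [f] modulo [P]; this is checked monomial by
   monomial. *)
suff: f - (f \mPo kill_vars A) \in P by rewrite f0 subr0.
elim/mpolyind: {f0} f => [|c m f _ _ IHf].
  by rewrite comp_mpoly0 subr0 prime_ideal0.
rewrite comp_mpolyD comp_mpolyZ opprD addrACA -scalerBr -mul_mpolyC.
apply: prime_idealMD => //.
have [/existsP[i /andP[Ai mi]]|] := boolP [exists i, (i \in A) && (0 < m i)%N].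
  have -> : m = (m - U_(i) + U_(i))%MM.
    by rewrite submK //; apply/mnm_lepP => j; rewrite mnm1E; case: eqP => // <-.
  rewrite mpolyXD rmorphM /= comp_mpolyXU -tnth_nth tnth_mktuple Ai mulr0 subr0.
  by apply: prime_idealM => //; apply: PA.
rewrite negb_exists => /forallP Am.
suff -> : 'X_[m] \mPo kill_vars A = 'X_[m] by rewrite subrr prime_ideal0.
rewrite comp_mpolyX [RHS]mpolyXE_id; apply: eq_bigr => i _.
rewrite tnth_mktuple; move: (Am i); case: ifP => //= _.
by rewrite -eqn0Ngt => /eqP->.
Qed.

Lemma var_ideal_strict A P i :
    prime_ideal P -> (forall j, j \in A -> 'X_j \in P) ->
    i \notin A -> 'X_i \in P -> strict_subset (var_ideal A) P.
Proof.
move=> prP PA nAi Pi; split; first exact: var_ideal_sub.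
by move/(_ _ Pi); rewrite var_idealX (negPf nAi).
Qed.

(** Dropping the variables of [A] one at a time gives strictly smaller primes below [P]. *)
Lemma prime_chain_vars A P :
  prime_ideal P -> (forall i, i \in A -> 'X_i \in P) -> prime_chain P #|A|.
Proof.
move: {2}#|A| (erefl #|A|) => k; elim: k A P => [|k IHk] A P cardA prP PA.
  by rewrite cardA; apply: prime_chain0.
have /card_gt0P[i Ai] : (0 < #|A|)%N by rewrite cardA.
have cardA' : #|A :\ i| = k by move: cardA; rewrite (cardsD1 i) Ai => -[].
rewrite cardA -cardA'; apply: (@prime_chainS _ (var_ideal (A :\ i))) => //.
  apply: IHk => // [|j]; first exact: var_ideal_prime.
  by rewrite var_idealX.
apply: (@var_ideal_strict _ _ i) => // [j /setD1P[_ /PA]//||].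
  by rewrite setD11.
exact: PA.
Qed.

(** Adjoining the variables outside [A] one by one prolongs the chain by [n - #|A|] steps, and the
    total length is at most [n]. *)
Lemma prime_chain_var_ideal_le A m :
  prime_chain (var_ideal A) m -> (m <= #|A|)%N.
Proof.
move: {2}#|~: A| (erefl #|~: A|) => k.
elim: k A m => [|k IHk] A m cardA chA.
  have := prime_chain_mpoly_le chA.
  by have := cardsC A; rewrite card_ord cardA addn0 => ->.
have /card_gt0P[i] : (0 < #|~: A|)%N by rewrite cardA.
rewrite inE => nAi; rewrite -ltnS.
have -> : #|A|.+1 = #|i |: A| by rewrite cardsU1 nAi.
apply: IHk.
  have := cardsC (i |: A); have := cardsC A.
  by rewrite cardA cardsU1 nAi => <-; rewrite addnS => -[/addnI].
apply: (prime_chainS chA (var_ideal_prime _)).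
apply: (@var_ideal_strict _ _ i) => //; first exact: var_ideal_prime.
  by move=> j Aj; rewrite var_idealX inE Aj orbT.
by rewrite var_idealX setU11.
Qed.

Lemma var_ideal_height A : prime_has_height (var_ideal A) #|A|.
Proof.
split; last exact: prime_chain_var_ideal_le.
by apply: prime_chain_vars => [|i]; [apply: var_ideal_prime|rewrite var_idealX].
Qed.

End VariableIdeals.

(** * Matchings, vertex covers and the height of the edge ideal *)

Lemma card_cover_setI (T : finType) (M : {set {set T}}) (A : {set T}) :
  trivIset M -> #|cover M :&: A| = \sum_(e in M) #|e :&: A|.
Proof.
move=> tiM; rewrite -sum1_card.
rewrite (eq_bigl (fun x => (x \in cover M) && (x \in A))) => [|x]; last by rewrite inE.
rewrite big_trivIset_cond //; apply: eq_bigr => e _.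
by rewrite -sum1_card; apply: eq_bigl => x; rewrite inE.
Qed.

Section Konig.
Variables (K : fieldType) (n : nat) (G : simple_graph n).

Definition vertex_cover (A : {set 'I_n}) :=
  forall i j, [set i; j] \in edges G -> (i \in A) || (j \in A).

Lemma prime_over_edge_idealP (P : {pred {mpoly K[n]}}) :
  prime_over (edge_ideal K G) P <->
  prime_ideal P /\ vertex_cover [set i | 'X_i%R \in P].
Proof.
split=> -[prP PG]; split=> //.
  move=> i j Gij; rewrite !inE; apply/orP/(prime_idealM_or prP)/PG.
  exists [:: (1, 'X_i * 'X_j)]%R; last by rewrite big_seq1 mul1r.
  by move=> p; rewrite inE => /eqP->; exists i, j.
move=> f [s sG ->]; rewrite big_seq.
elim/big_ind: _ => [|x y Px Py|p /sG[i [j [Gij ->]]]].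
- exact: prime_ideal0.
- by rewrite -[x]mul1r; apply: prime_idealMD.
- apply: prime_idealM => //; have := PG _ _ Gij; rewrite !inE.
  by case/orP=> PX; [rewrite mulrC|]; apply: prime_idealM.
Qed.

Lemma leq_card_matching_cover (M : {set {set 'I_n}}) (A : {set 'I_n}) :
  M \subset edges G -> trivIset M -> vertex_cover A -> #|M| <= #|A|.
Proof.
move=> /subsetP MG tiM covA; apply: leq_trans (subset_leq_card (subsetIr (cover M) A)).
rewrite card_cover_setI // -sum1_card; apply: leq_sum => e /MG Ge.
have /eqP/cards2P[i [j [_ def_e]]] := edges_card2 Ge.
rewrite card_gt0; apply/set0Pn; rewrite def_e in Ge *.
by case/orP: (covA _ _ Ge) => [Ai|Aj]; [exists i|exists j];
  rewrite !inE eqxx ?orbT ?Ai ?Aj.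
Qed.

Lemma matching_cover_height (M : {set {set 'I_n}}) (C : {set 'I_n}) :
    M \subset edges G -> trivIset M -> vertex_cover C -> #|C| = #|M| ->
  ideal_has_height (edge_ideal K G) #|M|.
Proof.
move=> MG tiM covC cardC; split=> [|P /prime_over_edge_idealP[prP covP]].
  exists (@var_ideal K n C); split; last by rewrite -cardC; apply: var_ideal_height.
  apply/prime_over_edge_idealP; split; first exact: var_ideal_prime.
  by move=> i j; rewrite !in_set !var_idealX; apply: covC.
exists #|[set i | 'X_i%R \in P]|; first exact: leq_card_matching_cover.
by apply: prime_chain_vars => // i; rewrite inE.
Qed.

(** The colour class [C] is a vertex cover meeting each edge of [M] exactly once; as [M] partitions
    the vertices, [#|C| = #|M|]. *)
Lemma bipartite_perfect_matching_Konig (M : {set {set 'I_n}}) (C : {set 'I_n}) :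
    M \subset edges G -> trivIset M -> cover M = [set: 'I_n] ->
    (forall i j, [set i; j] \in edges G -> (i \in C) (+) (j \in C)) ->
  perfect_matching_Konig K G M.
Proof.
move=> MG tiM covM bipC; split=> //; apply: (matching_cover_height (C := C)) => //.
  by move=> i j /bipC; case: (i \in C).
rewrite -[C]setTI -covM card_cover_setI // -sum1_card; apply: eq_bigr => e Me.
have Ge := subsetP MG _ Me; have /eqP/cards2P[i [j [_ def_e]]] := edges_card2 Ge.
rewrite def_e in Ge *; move: (bipC _ _ Ge); case: (boolP (i \in C)) => Ci /= Cj.
  rewrite (_ : _ :&: _ = [set i]) ?cards1 //; apply/setP => k; rewrite !inE.
  by case: eqP => [->|_] //=; case: eqP => [->|//]; apply/negbTE.
rewrite (_ : _ :&: _ = [set j]) ?cards1 //; apply/setP => k; rewrite !inE.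
by case: (eqVneq k j) => [->|_]; rewrite ?orbT ?orbF //=; case: eqP => [->|//]; apply/negbTE.
Qed.

End Konig.

(** * The grid: its colouring and its matching *)

Lemma B_edges_pair t (i j : 'I_(3 * t + 3)) : [set i; j] \in B_edges t ->
  B_arc t i.+1 j.+1 \/ B_arc t j.+1 i.+1.
Proof.
case/imsetP => -[a b]; rewrite inE /= => arc_ab /setP eq_ij.
have := eq_ij a; have := eq_ij b; rewrite !inE !eqxx orbT /=.
have lt_ab := B_arc_lt arc_ab.
case/orP=> /eqP eq_b; case/orP => /eqP eq_a; subst; first [by left|by right|by rewrite ltnn in lt_ab].
Qed.

(* Vertex i sits in row i %/ (t + 1); since t + 1 is even, its column has the
   parity of i. *)
Definition B_colour t : {set 'I_(3 * t + 3)} := [set i : 'I_(3 * t + 3) | odd (i + i %/ t.+1)].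

Lemma B_colour_bipartite t (i j : 'I_(3 * t + 3)) : odd t ->
  [set i; j] \in B_edges t -> (i \in B_colour t) (+) (j \in B_colour t).
Proof.
move=> t_odd /B_edges_pair; wlog: i j / B_arc t i.+1 j.+1.
  move=> IH [arc|arc]; first by apply: IH => //; left.
  by rewrite addbC; apply: IH => //; left.
rewrite !inE => /orP[/and4P[_ it i2t /eqP def_j]|/andP[_ /eqP def_j]] _.
  have -> : j = i.+1 :> nat by lia.
  (* Horizontal edge: [i.+1] is positive, less than [3 * t.+1], and differs from [t.+1] and
     [2 * t.+1], so the row does not change. *)
  have -> : i.+1 %/ t.+1 = i %/ t.+1.
    have lt_i := ltn_ord i; have lt_j := ltn_ord j.
    rewrite divnS // (_ : (_ %| _) = false) //.
    apply/negP => /dvdnP[q def_i]; have : q < 3 by nia.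
    by case: q def_i => [|[|[|]]] //; lia.
  by rewrite addSn /= addbN addbb.
(* Vertical edge: the index grows by the even number [t.+1] and the row by 1, so the colour
   flips. *)
have -> : j = i + t.+1 :> nat by lia.
by rewrite divnDr // divnn /= addnACA !oddD /= t_odd; case: (odd _) => //; case: odd.
Qed.

Definition B_matching t : {set {set 'I_(3 * t + 3)}} :=
  [set [set p.1; p.2] | p : 'I_(3 * t + 3) * 'I_(3 * t + 3)
     & ~~ odd p.1 && (val p.2 == p.1.+1)].

Theorem theorem4p9 (K : fieldType) (t : nat) (t_ge1 : (1 <= t)%N)
    (t_odd : odd t) :
  exists M : {set {set 'I_(3 * t + 3)}}, perfect_matching_Konig K (B_graph t) M.
Proof.
exists (B_matching t).
apply: (@bipartite_perfect_matching_Konig _ _ _ _ (B_colour t)) => [|||i j]; last first.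
- exact: B_colour_bipartite.
- apply/setP => i; rewrite inE; apply/bigcupP; have lt_i := ltn_ord i.
  have [odd_i|even_i] := boolP (odd i).
    have lt_p : i.-1 < 3 * t + 3 by lia.
    exists [set Ordinal lt_p; i]; last by rewrite set22.
    by apply/imsetP; exists (Ordinal lt_p, i); rewrite // inE /=; lia.
  (* As [3 * t + 3] is even, an even index is never the last one. *)
  have lt_s : i.+1 < 3 * t + 3 by lia.
  exists [set i; Ordinal lt_s]; last by rewrite set21.
  by apply/imsetP; exists (i, Ordinal lt_s); rewrite // inE /=; lia.
- apply/trivIsetP => _ _ /imsetP[[a b] + ->] /imsetP[[c d] + ->].
  rewrite !inE /= => /andP[ev_a /eqP def_b] /andP[ev_c /eqP def_d] neq.
  have neq_ac : a != c.
    apply: contraNneq neq => eq_ac; rewrite -{}eq_ac in def_d *.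
    by rewrite (_ : b = d) //; apply: val_inj; rewrite /= def_b.
  rewrite disjoints_subset; apply/subsetP => k; rewrite !inE -!val_eqE /= in neq_ac *.
  lia.
apply/subsetP => _ /imsetP[[a b] + ->]; rewrite inE /= => /andP[ev_a /eqP def_b].
apply/imsetP; exists (a, b) => //; rewrite inE /B_arc /=.
(* The 1-based label [a.+1] is odd, while the row ends [t + 1] and [2 * t + 2] are even, so no pair
   straddles two rows. *)
have := ltn_ord b; lia.
Qed.
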